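(* Geometric progressions with sufficiently large common ratios have the highest possible complexity: for every integer $M\ge2$ there is a real number $r_0$ (depending only on $M$) such that for every $r\ge r_0$ and every real $a\ne0$, the set $\mathcal{A}=\{ar^i\mid 0\le i\le M-1\}$ has complexity $C(\mathcal{A})=M-1$.
   Context: For a finite set $\mathcal{A}\subset\mathbb{R}$, the complexity $C(\mathcal{A})$ is the smallest positive integer $\theta$ for which there exist (not necessarily distinct) real numbers $x_1,\dots,x_\theta,y_1,\dots,y_\theta$ with $\mathcal{A}\subseteq\{x_1,y_1\}+\{x_2,y_2\}+\cdots+\{x_\theta,y_\theta\}$, where $+$ denotes the sumset $\mathcal{S}+\mathcal{T}=\{s+t\mid s\in\mathcal{S},t\in\mathcal{T}\}$. The highest possible complexity of a set of size $M\ge2$ is $M-1$. *)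

(* Defs.v *)
From mathcomp Require Import all_boot all_order all_algebra.
From mathcomp Require Import finmap.
From mathcomp Require Import boolp reals.

Set Implicit Arguments.
Unset Strict Implicit.
Unset Printing Implicit Defensive.

Import Order.TTheory GRing.Theory Num.Theory.

Local Open Scope fset_scope.
Local Open Scope ring_scope.

Definition sumset (R : realType) (S T : {fset R}) : {fset R} :=
  [fset s + t | s in S, t in T].

(* {x_1, y_1} + ... + {x_theta, y_theta}; the unit [fset 0] of sumset is the
   value of the empty sum and does not affect a nonempty one. *)
Definition pair_sumset (R : realType) (theta : nat) (x y : 'I_theta -> R) :
    {fset R} :=
  \big[@sumset R/[fset 0]]_(i < theta) [fset x i; y i].

Definition covered_by_pairs (R : realType) (A : {fset R}) (theta : nat) : Prop :=
  exists x y : 'I_theta -> R, A `<=` pair_sumset x y.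

Lemma pair_sumset_choice (R : realType) (theta : nat) (x y : 'I_theta -> R)
    (b : 'I_theta -> bool) :
  \sum_(i < theta) (if b i then y i else x i) \in pair_sumset x y.
Proof.
rewrite /pair_sumset; elim/big_ind2: _ => [|S u T v uS vT|i _].
- by rewrite in_fset1.
- by apply/imfset2P; exists u => //; exists v.
- by rewrite in_fset2; case: (b i); rewrite eqxx ?orbT.
Qed.

(* Makes complexity total: a finite set A is contained in
   {0, 0} + \sum_(a in A) {0, a}. *)
Lemma complexity_exists (R : realType) (A : {fset R}) :
  exists theta : nat, (0 < theta)%N && `[< covered_by_pairs A theta >].
Proof.
exists (size A).+1; apply/asboolP.
exists (fun=> 0), (fun i => nth 0 A i); apply/fsubsetP => a aA.
have lt_a : (index a A < (size A).+1)%N by rewrite ltnS index_size.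
have := pair_sumset_choice (fun=> 0) (fun i : 'I_(size A).+1 => nth 0 A i)
  (fun i => i == Ordinal lt_a).
rewrite -big_mkcond big_pred1_eq /= nth_index //.
Qed.

Definition complexity (R : realType) (A : {fset R}) : nat :=
  ex_minn (complexity_exists A).

Definition geometric_progression (R : realType) (M : nat) (a r : R) :
    {fset R} :=
  [fset a * r ^+ nat_of_ord i | i : 'I_M].

(* Main.v *)
Require Import Defs.
From mathcomp Require Import all_boot all_order all_algebra.
From mathcomp Require Import finmap.
From mathcomp Require Import boolp reals.

Import Order.TTheory GRing.Theory Num.Theory.

Local Open Scope fset_scope.
Local Open Scope ring_scope.

(** If the progression lies in a sum of theta < M - 1 pairs {x_j, y_j}, then
    a (r^i)_i = c 1 + B d with c = \sum_j x_j, d_j = y_j - x_j and B a 0/1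
    matrix.  The M x (1 + theta) matrix [1 | B] has a nonzero left kernel
    vector v, so r is a root of the nonzero polynomial \sum_i v_i X^i.  There
    are only finitely many such matrices, hence finitely many such r. *)

(** Distinct indices let the summand chosen for the head be added to the choice function without
    disturbing the choices already made on the tail. *)
Lemma mem_big_sumset {R : realType} {I : eqType} {s : seq I}
    {F : I -> {fset R}} {u : R} :
  uniq s -> u \in \big[@sumset R/[fset 0]]_(i <- s) F i ->
  exists2 f : I -> R, {in s, forall i, f i \in F i} & u = \sum_(i <- s) f i.
Proof.
elim: s u => [|i s IHs] u /=.
  by rewrite big_nil in_fset1 => _ /eqP->; exists (fun=> 0); rewrite ?big_nil.
case/andP=> i_s uniq_s; rewrite big_cons => /imfset2P[v /= vF [w /= ws ->]].
have [f fF ->] := IHs w uniq_s ws.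
exists (fun j => if j == i then v else f j).
  by move=> j; rewrite inE; case: eqP => [-> | _] //=; apply: fF.
rewrite big_cons eqxx; congr (_ + _); apply: eq_big_seq => j js.
by case: eqP js i_s => // -> ->.
Qed.

Lemma pair_sumsetP {R : realType} {theta : nat} {x y : 'I_theta -> R} {u : R} :
  u \in pair_sumset x y ->
  exists b : 'I_theta -> bool, u = \sum_i (if b i then y i else x i).
Proof.
case/mem_big_sumset=> [|f fxy ->]; first exact: index_enum_uniq.
exists (fun i => f i == y i); apply: eq_bigr => i _.
have := fxy i (mem_index_enum i); rewrite in_fset2.
by case: (f i =P y i) => [-> | _] //; rewrite orbF => /eqP.
Qed.

(** This is the upper bound [M - 1]. The first pair carries the base point [f ord0]; switching pair
    [j] alone adds the difference that leads to [f (lift ord0 j)], and switching none leaves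
    [f ord0]. *)
Lemma covered_by_pairs_family {R : realType} {n : nat} (f : 'I_n.+2 -> R) :
  covered_by_pairs [fset f i | i : 'I_n.+2] n.+1.
Proof.
pose x (i : 'I_n.+1) := if i == ord0 then f ord0 else 0.
pose d (i : 'I_n.+1) := f (lift ord0 i) - f ord0.
have sum_x : \sum_i x i = f ord0 by rewrite -big_mkcond big_pred1_eq.
exists x, (fun i => x i + d i); apply/fsubsetP => _ /imfsetP[k _ ->] /=.
case: (unliftP ord0 k) => [j|] ->.
  have := pair_sumset_choice x (fun i => x i + d i) (pred1 j).
  rewrite (eq_bigr (fun i => x i + (if i == j then d i else 0))); last first.
    by move=> i _ /=; case: eqP; rewrite ?addr0.
  by rewrite big_split /= sum_x -big_mkcond big_pred1_eq addrC subrK.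
have := pair_sumset_choice x (fun i => x i + d i) pred0.
by rewrite /= sum_x.
Qed.

Lemma wide_left_kernel {F : fieldType} {m n : nat} (A : 'M[F]_(m, n)) :
  (n < m)%N -> exists2 v : 'rV[F]_m, v != 0 & v *m A = 0.
Proof.
move=> lt_nm; exists (nz_row (kermx A)).
  rewrite nz_row_eq0 -mxrank_eq0 mxrank_ker subn_eq0 -ltnNge.
  exact: leq_ltn_trans (rank_leq_col A) lt_nm.
by apply/eqP; rewrite -sub_kermx nz_row_sub.
Qed.

(** Roots are split off one at a time by induction on the size; from [x + 1] on, the factor at a
    root [x] cannot vanish. Once no real root is left, any threshold works. *)
Lemma poly_eventually_neq0 {R : realType} (p : {poly R}) :
  p != 0 -> exists r0 : R, forall r, r0 <= r -> p.[r] != 0.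
Proof.
have [n] := ubnP (size p); elim: n p => // n IHn p le_pn p_neq0.
have [[x /factor_theorem[q Dp]] | no_root] := pselect (exists x, root p x).
  have q_neq0 : q != 0 by apply: contraNneq p_neq0 => q0; rewrite Dp q0 mul0r.
  have [|r1 r1P] := IHn q _ q_neq0.
    by move: le_pn; rewrite Dp size_Mmonic ?monicXsubC // size_XsubC addn2.
  exists (Num.max r1 (x + 1)) => r; rewrite ge_max => /andP[le_r1 le_x1].
  rewrite Dp hornerM mulf_neq0 ?r1P // hornerXsubC subr_eq0 gt_eqF //.
  by apply: lt_le_trans le_x1; rewrite ltrDl ltr01.
by exists 0 => r _; apply/negP => pr0; apply: no_root; exists r.
Qed.

Definition pattern_mx (R : realType) {M theta : nat}
    (B : 'M[bool]_(M, theta)) : 'M[R]_(M, 1 + theta) :=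
  row_mx (const_mx 1) (map_mx (fun b : bool => b%:R) B).

Lemma covered_pattern {R : realType} {M theta : nat} {g : 'I_M -> R} :
  covered_by_pairs [fset g i | i : 'I_M] theta ->
  exists B : 'M[bool]_(M, theta), exists w, \col_i g i = pattern_mx R B *m w.
Proof.
case=> x [y /fsubsetP gxy].
have /choice[b bP] (i : 'I_M) : exists b : 'I_theta -> bool,
    g i = \sum_j (if b j then y j else x j).
  by apply: pair_sumsetP; apply: gxy; apply/imfsetP; exists i.
exists (\matrix_(i, j) b i j).
exists (col_mx (const_mx (\sum_j x j)) (\col_j (y j - x j))).
rewrite mul_row_col; apply/colP => i.
rewrite !mxE big_ord1 !mxE mul1r bP -big_split; apply: eq_bigr => j _ /=.
by rewrite !mxE; case: (b i j); rewrite ?mul0r ?addr0 // mul1r addrC subrK.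
Qed.

(** The kernel vector is built from [B] alone, so one polynomial serves all [a], [r] and [w]; this
    is what makes the final bound uniform in [a]. *)
Lemma pattern_avoids_geometric {R : realType} {M theta : nat}
    (B : 'M[bool]_(M, theta)) :
  (theta.+1 < M)%N ->
  exists2 p : {poly R}, p != 0 & forall a r w, a != 0 ->
    \col_(i < M) (a * r ^+ i) = pattern_mx R B *m w -> root p r.
Proof.
move=> lt_theta; have [v v_neq0 vB] := wide_left_kernel (pattern_mx R B) lt_theta.
exists (rVpoly v) => [|a r w a_neq0 Dg].
  by apply: contraNneq v_neq0 => v0; rewrite -[v]rVpolyK v0 linear0.
have /matrixP/(_ 0 0) : v *m \col_(i < M) (a * r ^+ i) = 0.
  by rewrite Dg mulmxA vB mul0mx.
rewrite !mxE => sum0.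
(* The single entry of the vanishing product is [a * p.[r]], and the nonzero factor [a] cancels. *)
rewrite rootE -(mulrI_eq0 _ (lregP a_neq0)) -[X in _ == X]sum0.
rewrite (horner_coef_wide r (size_poly _ _)) mulr_sumr; apply/eqP.
by apply: eq_bigr => i _; rewrite coef_rVpoly_ord mxE mulrCA.
Qed.

Theorem proposition8 (R : realType) (M : nat) (hM : (2 <= M)%N) :
  exists r0 : R, forall r : R, r0 <= r -> forall a : R, a != 0 ->
    complexity (geometric_progression M a r) = (M - 1)%N.
Proof.
(* The pairs of a width [t < M - 1] and a 0/1 matrix of that width form a finite type, so the
   product of their polynomials yields one threshold for all of them. *)
have /choice[p pP] (tB : {t : 'I_(M - 1) & 'M[bool]_(M, t)}) :
    exists p : {poly R}, p != 0 /\ forall a r w, a != 0 ->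
      \col_(i < M) (a * r ^+ i) = pattern_mx R (tagged tB) *m w -> root p r.
  have [|p p_neq0 pP] := pattern_avoids_geometric (R := R) (tagged tB).
    by have := ltn_ord (tag tB); rewrite ltn_subRL add1n.
  by exists p.
have [|r0 r0P] := poly_eventually_neq0 (\prod_tB p tB).
  by apply/prodf_neq0 => tB _; case: (pP tB).
exists r0 => r le_r0 a a_neq0.
rewrite /complexity; case: ex_minnP => theta /andP[_ /asboolP cov_theta] min_theta.
apply/eqP; rewrite eqn_leq min_theta /=; last first.
  rewrite subn_gt0 hM; apply/asboolP.
  by case: M hM {p pP r0P min_theta cov_theta} => [|[|n]] // _;
    rewrite subn1; apply: covered_by_pairs_family.
rewrite leqNgt; apply/negP => lt_theta.
have [B [w Dg]] := covered_pattern cov_theta.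
have := r0P r le_r0; rewrite horner_prod => /prodf_neq0.
(* A cover by [theta < M - 1] pairs produces a matrix among those indexed in the product, so its
   polynomial is nonzero at [r], yet [r] is a root of it. *)
pose tB : {t : 'I_(M - 1) & 'M[bool]_(M, t)} :=
  Tagged (fun t : 'I_(M - 1) => 'M[bool]_(M, t)) (B : 'M_(M, Ordinal lt_theta)).
move=> /(_ tB isT); have [_ root_p] := pP tB.
by have /rootP-> := root_p a r w a_neq0 Dg; rewrite eqxx.
Qed.
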